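(* Let $k$ be a field. There exists a finitely generated prime monomial $k$-algebra $A$ of GK dimension $2$ with unbounded matrix images.
   Context: Algebras are associative and unital. A monomial algebra is an algebra $A\cong k\{x_1,\ldots,x_d\}/I$ where $k\{x_1,\ldots,x_d\}$ is the free algebra and $I$ is an ideal generated by monomials (words) in $x_1,\ldots,x_d$. A frame of a finitely generated $k$-algebra $A$ is a finite-dimensional $k$-subspace $V$ of $A$ with $1\in V$ that generates $A$ as a $k$-algebra; $\mathrm{GKdim}(A)=\limsup_{n\to\infty}\log(\dim_k V^n)/\log n$ for any frame $V$. $A$ has unbounded matrix images if there is no positive integer $N$ such that every prime homomorphic image of $A$ that is finite-dimensional over $k$ satisfies the standard identity $S_{2N}$ (equivalently, has PI degree at most $N$). *)

(* Defs.v *)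
From HB Require Import structures.
From mathcomp Require Import all_boot all_order all_algebra all_fingroup.
From mathcomp Require Import all_classical all_reals all_analysis.
(* The notations of monalg clash with those of the analysis library. *)
From mathcomp Require Import -(notations) monalg.

Set Implicit Arguments.
Unset Strict Implicit.
Unset Printing Implicit Defensive.

Import Order.TTheory GRing.Theory Num.Theory.

Local Open Scope classical_set_scope.
Local Open Scope ring_scope.

Definition word (d : nat) : Type := seq 'I_d.

HB.instance Definition _ (d : nat) := Choice.on (word d).

Lemma word_unit (d : nat) (u v : word d) :
  u ++ v = [::] -> u = [::] /\ v = [::].
Proof. by case: u. Qed.

HB.instance Definition _ (d : nat) :=
  monalg.Choice_isMonomialDef.Build (word d)
    (@catA 'I_d) (@cat0s 'I_d) (@cats0 'I_d) (@word_unit d).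

(* The free algebra k{x_1, ..., x_d}: finitely supported functions from words
   to k, with the convolution product. *)
Notation free_algebra k d := (monalg.malg (word d) k).

Definition monomial (k : fieldType) (d : nat) (w : word d) :
  free_algebra k d := monalg.mkmalgU w (1 : k).

(* Two-sided ideal generated by X. *)
Definition ideal_gen (T : nzRingType) (X : set T) : set T :=
  [set p | exists (n : nat) (a x b : 'I_n -> T),
     (forall i, X (x i)) /\ p = \sum_(i < n) a i * x i * b i].

Definition surjective (S T : Type) (f : S -> T) : Prop :=
  forall y, exists x, f x = y.

(* A is isomorphic to k{x_1, ..., x_d} / I with I generated by words: the
   isomorphism is given as a surjective morphism with kernel I. *)
Definition monomial_algebra (k : fieldType) (A : algType k) : Prop :=
  exists (d : nat) (W : set (word d))
         (f : {lrmorphism free_algebra k d -> A}),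
    surjective f /\
    forall p : free_algebra k d,
      f p = 0 <-> ideal_gen [set monomial k w | w in W] p.

(* The trivial ring is excluded by nzRingType. *)
Definition prime_ring (T : nzRingType) : Prop :=
  forall a b : T, (forall x : T, a * x * b = 0) -> a = 0 \/ b = 0.

(* k-linear span of X. *)
Definition lin_span (k : fieldType) (A : lmodType k) (X : set A) : set A :=
  [set a | exists (n : nat) (c : 'I_n -> k) (x : 'I_n -> A),
     (forall i, X (x i)) /\ a = \sum_(i < n) c i *: x i].

Definition lin_indep (k : fieldType) (A : lmodType k) (s : seq A) : Prop :=
  forall c : 'I_(size s) -> k,
    \sum_(i < size s) c i *: s`_i = 0 -> forall i, c i = 0.

(* V is a finite-dimensional k-subspace of A. *)
Definition fin_dim_subspace (k : fieldType) (A : lmodType k) (V : set A) :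
  Prop := exists s : seq A, V = lin_span [set` s].

(* Dimension of a finite-dimensional subspace V, as the size of a basis
   (junk value 0 if V has no finite basis). *)
Definition subspace_dim (k : fieldType) (A : lmodType k) (V : set A) : nat :=
  xget 0%N [set n | exists s : seq A,
    [/\ size s = n, lin_indep s & V = lin_span [set` s]]].

Definition generates (k : fieldType) (A : algType k) (X : set A) : Prop :=
  forall S : {pred A}, GRing.subalg_closed S ->
    (forall x, X x -> x \in S) -> forall a, a \in S.

Definition finitely_generated (k : fieldType) (A : algType k) : Prop :=
  exists s : seq A, generates [set` s].

Definition frame (k : fieldType) (A : algType k) (V : set A) : Prop :=
  [/\ fin_dim_subspace V, V 1 & generates V].

(* The subspace V^n spanned by the products of n elements of V. *)
Definition subspace_exp (k : fieldType) (A : algType k) (V : set A) (n : nat) :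
  set A :=
  lin_span [set \prod_(i < n) v i | v in [set v : 'I_n -> A |
    forall i, V (v i)]].

(* limsup_n log (dim V^n) / log n; the terms n = 0, 1, where log n is 0,
   do not matter. *)
Definition growth_exponent (R : realType) (k : fieldType) (A : algType k)
  (V : set A) : \bar R :=
  limn_esup (fun n : nat =>
    (ln (subspace_dim (subspace_exp V n))%:R / ln n%:R)%:E).

(* The value of the limsup is required for every frame; frames exist exactly
   when A is finitely generated. *)
Definition has_GKdim (R : realType) (k : fieldType) (A : algType k)
  (g : \bar R) : Prop :=
  finitely_generated A /\
  forall V : set A, frame V -> growth_exponent R V = g.

Definition finite_dimensional (k : fieldType) (A : lmodType k) : Prop :=
  fin_dim_subspace [set: A].

(* T satisfies the standard identity S_n. *)
Definition standard_identity (T : nzRingType) (n : nat) : Prop :=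
  forall x : 'I_n -> T,
    \sum_(s : 'S_n) (-1) ^+ s * \prod_(i < n) x (s i) = 0.

Definition unbounded_matrix_images (k : fieldType) (A : algType k) : Prop :=
  ~ exists N : nat, (0 < N)%N /\
      forall (B : algType k) (f : {lrmorphism A -> B}),
        surjective f -> prime_ring B -> finite_dimensional B ->
        standard_identity B (2 * N).

(* Main.v *)
Require Import Defs.
From HB Require Import structures.
From mathcomp Require Import all_boot all_order all_algebra all_fingroup finmap.
From mathcomp Require Import all_classical all_reals all_analysis.
From mathcomp Require Import -(notations) monalg.
From mathcomp Require Import zify lra.

Set Implicit Arguments.
Unset Strict Implicit.
Unset Printing Implicit Defensive.

Import Order.TTheory GRing.Theory Num.Theory.

(** The algebra has a basis of words: the factors of the words
      u_0 = x,   u_(n+1) = u_n s_n u_n,   s_n = (y^(2^i) x)^(|u_n|),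
    where i is the 2-adic valuation of n. A product of two basis words is
    their concatenation if this is again a factor of some u_m, and 0
    otherwise.

    Primeness. Two factors of u_n occur one after the other in u_(n+1)
    ([ruler_lang_prime]). If a and b are nonzero, with longest words u and v,
    and if u w v is in the language, then no other pair of words of a and b
    contributes to the coefficient of u w v in a w b, which is therefore
    nonzero ([mon_prime]).

    Matrix images. Every i is the valuation of infinitely many n, so all
    powers of the block y^(2^i) x are in the language. Reading a word along
    the cycle of length 2^i + 1 labelled by this block represents the algebra
    by matrices of this size, where a word that is not a factor of a power of
    the block acts as 0. All matrix units are images of words
    ([mon_mx_surjective]), and full matrix algebras of growing size satisfy no
    common standard identity ([matrix_standard_identityN]).

    Growth. For a length l, choose the least k such that s_k has length at
    least l. A factor of length at most l then meets at most one copy of u_k,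
    which has length at most 3 l, and what surrounds this copy is a tail of a
    power of a block on either side. Tails of length l are the same for all
    blocks with 2^i >= l, so that each side leaves only log l possibilities;
    hence there are O(l^2 (log l)^2) factors of length at most l
    ([ruler_lang_upper]). The factors y^a x y^b give a quadratic lower bound.
    For a frame V, these bounds transfer to V^n because V lies in some bounded
    degree and some power of V contains the letters, and the logarithmic
    factor does not change the exponent 2 ([growth_exponent_quadratic]). *)

(** * Factors of concatenations and of powers *)

Section Combinatorics.
Local Open Scope nat_scope.

Section Factors.
Variable T : eqType.
Implicit Types u A B C S P X Y z : seq T.

Lemma prefix_cat_or u A B : prefix u (A ++ B) ->
  prefix u A \/ exists2 P, u = A ++ P & prefix P B.
Proof.
elim: A u => [|a A IH] u; first by right; exists u.
case: u => [|c u]; first by left; rewrite prefix0s.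
rewrite cat_cons prefix_cons => /andP[/eqP -> /IH [h|[P -> h]]].
  by left; rewrite prefix_cons eqxx.
by right; exists P.
Qed.

Lemma infix_cat_or u A B : infix u (A ++ B) ->
  [\/ infix u A, infix u B |
      exists S P, [/\ u = S ++ P, suffix S A & prefix P B]].
Proof.
elim: A => [|a A IH]; first by move=> h; constructor 2.
rewrite cat_cons infix_consl -cat_cons => /orP[].
  case/prefix_cat_or => [h|[P -> h]]; first by constructor 1; exact: prefixW.
  by constructor 3; exists (a :: A), P; rewrite suffix_refl.
case/IH => [h|h|[S [P [-> hS hP]]]].
- by constructor 1; rewrite infix_consl h orbT.
- by constructor 2.
- constructor 3; exists S, P; split=> //.
  exact: suffix_trans hS (suffix_cons _ _).
Qed.

(** A window that is not longer than B cannot meet both A and C. *)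
Lemma infix_overlap u A B C : size u <= size B -> infix u (A ++ B ++ C) ->
  infix u (A ++ B) \/ infix u (B ++ C).
Proof.
move=> le_u /infix_cat_or[h|h|[S [P [Eu hS]]]].
- by left; exact: infix_catr.
- by right.
case/prefix_cat_or => [h|[Q EP _]]; last first.
  have : size S + size Q = 0 by move: le_u; rewrite Eu EP !size_cat; lia.
  case: S Q Eu hS EP => [|//] [|//] /= -> _ -> _.
  by left; rewrite cats0; exact: suffix_infix.
left; case/suffixP: hS => A' ->; case/prefixP: h => B' ->; rewrite Eu.
by rewrite -!catA (catA S P); exact: infix_infix.
Qed.

Lemma size_cat_le u S P l : u = S ++ P -> size u <= l ->
  size S <= l /\ size P <= l.
Proof. by move=> ->; rewrite size_cat => h; split; lia. Qed.

Lemma suffix_of_suffix S X Y : suffix S X -> suffix Y X -> size S <= size Y ->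
  suffix S Y.
Proof.
rewrite !suffixE => /eqP hS /eqP hY le.
rewrite -[X in drop _ X]hY drop_drop -[X in _ == X]hS.
have : size Y <= size X by rewrite -hY size_drop; lia.
by move=> leYX; apply/eqP; congr (drop _ _); lia.
Qed.

Lemma prefix_of_prefix S X Y : prefix S X -> prefix Y X -> size S <= size Y ->
  prefix S Y.
Proof.
by rewrite !prefixE => /eqP hS /eqP hY le; rewrite -{1}hY take_takel // hS.
Qed.

Definition wpow z m := flatten (nseq m z).

Lemma wpowS z m : wpow z m.+1 = z ++ wpow z m. Proof. by []. Qed.

Lemma wpowD z m n : wpow z (m + n) = wpow z m ++ wpow z n.
Proof. by rewrite /wpow nseqD flatten_cat. Qed.

Lemma size_wpow z m : size (wpow z m) = m * size z.
Proof. by elim: m => // m IH; rewrite wpowS size_cat IH mulSn. Qed.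

(** For nonempty z, the exponent l is large enough for z^l to have length at
    least l, so these are the length-l tails of the words ...zzz and zzz... *)
Definition left_tail z l := drop (size (wpow z l) - l) (wpow z l).
Definition right_tail z l := take l (wpow z l).

Lemma size_left_tail z l : size (left_tail z l) <= l.
Proof. by rewrite size_drop; lia. Qed.

Lemma size_right_tail z l : size (right_tail z l) <= l.
Proof. by rewrite size_take_min geq_minl. Qed.

Lemma suffix_left_tail z l a S : 0 < size z ->
  suffix S (wpow z a) -> size S <= l -> suffix S (left_tail z l).
Proof.
move=> z0 hS le; have le' : l <= size (wpow z l) by rewrite size_wpow leq_pmulr.
apply: (@suffix_of_suffix _ (wpow z (a + l))).
- by rewrite addnC wpowD; exact: suffix_catr.
- by rewrite wpowD; apply/suffix_catr/suffix_drop.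
- by rewrite size_drop subKn.
Qed.

Lemma prefix_right_tail z l a P : 0 < size z ->
  prefix P (wpow z a) -> size P <= l -> prefix P (right_tail z l).
Proof.
move=> z0 hS le; have le' : l <= size (wpow z l) by rewrite size_wpow leq_pmulr.
apply: (@prefix_of_prefix _ (wpow z (a + l))).
- by rewrite wpowD; exact: prefix_catl.
- by rewrite addnC wpowD; apply/prefix_catl/prefix_take.
- by rewrite size_takel.
Qed.

End Factors.

(** * The ruler words and their factors *)

Definition lx : 'I_2 := ord0.
Definition ly : 'I_2 := ord_max.
Definition block i : seq 'I_2 := rcons (nseq (2 ^ i) ly) lx.

(** The 2-adic valuation serves as a sequence that takes every value infinitely
    often, with exponents |ruler m| that tend to infinity. *)
Fixpoint ruler n : seq 'I_2 :=
  if n is m.+1 then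
    ruler m ++ wpow (block (logn 2 m)) (size (ruler m)) ++ ruler m
  else [:: lx].

Definition ruler_lang (u : seq 'I_2) : Prop := exists n, infix u (ruler n).

Definition spacer n := wpow (block (logn 2 n)) (size (ruler n)).

Lemma rulerS n : ruler n.+1 = ruler n ++ spacer n ++ ruler n. Proof. by []. Qed.

Lemma size_block i : size (block i) = (2 ^ i).+1.
Proof. by rewrite size_rcons size_nseq. Qed.

Lemma infix_ruler m n : m <= n -> infix (ruler m) (ruler n).
Proof.
move/subnK <-; elim: (n - m) => [|d IH]; first exact: infix_refl.
by rewrite addSn rulerS; exact: infix_catr.
Qed.

Lemma size_ruler n : n < size (ruler n).
Proof.
elim: n => // n IH; rewrite rulerS !size_cat; move: IH; lia.
Qed.

Lemma size_spacer n : size (spacer n) = size (ruler n) * (2 ^ logn 2 n).+1.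
Proof. by rewrite size_wpow size_block. Qed.

Lemma size_spacer_mono m n : m <= n -> size (spacer m) <= size (spacer n).
Proof.
move/subnK <-; elim: (n - m) => [|d IH]; first exact: leqnn.
apply: (leq_trans IH); rewrite addSn [size (spacer _.+1)]size_spacer mulnS.
by apply: leq_trans (leq_addr _ _); rewrite rulerS !size_cat addnCA leq_addr.
Qed.

Lemma ruler_lang_nil : ruler_lang [::]. Proof. by exists 0. Qed.

Lemma ruler_lang_infix u v : infix u v -> ruler_lang v -> ruler_lang u.
Proof. by move=> h [n hn]; exists n; exact: infix_trans h hn. Qed.

Lemma ruler_lang_prime u v : ruler_lang u -> ruler_lang v ->
  exists w, ruler_lang (u ++ w ++ v).
Proof.
move=> [m hm] [n hn].
have /infixP[s [s' Eu]] := infix_trans hm (infix_ruler (leq_maxl m n)).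
have /infixP[t [t' Ev]] := infix_trans hn (infix_ruler (leq_maxr m n)).
exists (s' ++ spacer (maxn m n) ++ t), (maxn m n).+1; rewrite rulerS {1}Eu Ev.
by apply/infixP; exists s, t'; rewrite -!catA.
Qed.

Lemma ruler_lang_block_pow i m : ruler_lang (wpow (block i) m).
Proof.
(* The odd factor keeps the valuation i and makes n at least m. *)
set n := 2 ^ i * m.*2.+1.
have En : logn 2 n = i.
  rewrite lognM ?expn_gt0 // pfactorK // logn_coprime ?addn0 //.
  by rewrite coprime2n /= odd_double.
have le : m <= size (ruler n).
  apply: leq_trans (ltnW (size_ruler n)); rewrite /n.
  have : 0 < 2 ^ i by rewrite expn_gt0.
  by case: (2 ^ i) => // q _; nia.
exists n.+1; rewrite rulerS; apply/infix_catl/infix_catr.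
by rewrite /spacer En -(subnKC le) wpowD; apply: prefix_infix.
Qed.

Lemma infix_nseq_block i a b : a <= 2 ^ i -> b <= 2 ^ i ->
  infix (nseq a ly ++ lx :: nseq b ly) (wpow (block i) 2).
Proof.
move=> ha hb; rewrite /wpow /= cats0 /block -!cats1.
have Ea : nseq (2 ^ i) ly = nseq (2 ^ i - a) ly ++ nseq a ly.
  by rewrite -nseqD subnK.
have Eb : nseq (2 ^ i) ly = nseq b ly ++ nseq (2 ^ i - b) ly.
  by rewrite -nseqD subnKC.
apply/infixP; exists (nseq (2 ^ i - a) ly), (nseq (2 ^ i - b) ly ++ [:: lx]).
by rewrite {1}Ea Eb -!catA.
Qed.

Lemma ruler_lang_two_gaps a b : ruler_lang (nseq a ly ++ lx :: nseq b ly).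
Proof.
apply: ruler_lang_infix (ruler_lang_block_pow (a + b) 2).
have lt : a + b < 2 ^ (a + b) by exact: ltn_expl.
apply: infix_nseq_block; lia.
Qed.

(** * Counting the factors of bounded length *)

(** Above level k every spacer is at least as long as the window, so a window
    into ruler n.+1 sees only one of the two copies of ruler n, next to a
    spacer; descending in n leaves a copy of ruler k between two powers. *)
Lemma ruler_lang_two_sided l k u : (forall j, k <= j -> l <= size (spacer j)) ->
  size u <= l -> ruler_lang u ->
  exists i j a b, infix u (wpow (block i) a ++ ruler k ++ wpow (block j) b).
Proof.
move=> hk le_u [n0 hn0].
have {hn0}: exists i j a b,
    infix u (wpow (block i) a ++ ruler (maxn n0 k) ++ wpow (block j) b).
  exists 0, 0, 0, 0; rewrite /= cats0.
  exact: infix_trans hn0 (infix_ruler (leq_maxl _ _)).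
rewrite -(subnK (leq_maxr n0 k)); elim: (_ - k) => // d IH [i [j [a [b]]]].
rewrite addSn rulerS -!catA !(catA _ _ (spacer _ ++ _)).
case/infix_overlap; rewrite -?catA.
- by rewrite (leq_trans le_u) // hk // leq_addl.
- by move=> h; apply: IH; exists i, (logn 2 (d + k)), a, (size (ruler (d + k))).
- by move=> h; apply: IH; exists (logn 2 (d + k)), j, (size (ruler (d + k))), b.
Qed.

(** A factor of one block is a power of y, hence a prefix of the block, or ends
    in x, hence is a suffix of it. So every factor of a power of the block can
    be cut into a left tail followed by a right tail, with nothing between. *)
Lemma infix_block_pow u i a : infix u (wpow (block i) a) ->
  exists S P c d, [/\ u = S ++ P, suffix S (wpow (block i) c) &
                      prefix P (wpow (block i) d)].
Proof.
elim: a => [|a IH].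
  by rewrite infixs0 => /eqP ->; exists [::], [::], 0, 0.
rewrite wpowS => /infix_cat_or[|//|[S [P [-> hS hP]]]]; last first.
  by exists S, P, 1, a; rewrite /wpow /= cats0.
rewrite {1}/block infix_rconsl => /orP[h|h].
  by exists u, [::], 1, 0; rewrite /wpow /= !cats0.
case/infixP: h => s [s' E].
have -> : u = nseq (size u) ly.
  apply/all_pred1P; have := all_pred1_nseq ly (2 ^ i).
  by rewrite E !all_cat; case/and3P.
exists [::], (nseq (size u) ly), 0, 1; split=> //.
rewrite /wpow /= cats0 /block -cats1.
apply: prefix_catl; apply/prefixP; exists (nseq (2 ^ i - size u) ly).
by rewrite -nseqD subnKC // -(size_nseq (2 ^ i) ly) E !size_cat addnCA leq_addr.
Qed.

(** For l <= 2^i the length-l tails are y^(l-1) x and y^l, whatever i is. This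
    is why exponentially growing blocks cost only a logarithmic factor. *)
Lemma tail_stable l i j : l <= 2 ^ i -> l <= 2 ^ j ->
  left_tail (block i) l = left_tail (block j) l /\
  right_tail (block i) l = right_tail (block j) l.
Proof.
(* Writing y^(l-1) x as the tail of y^l x covers l = 0 as well. *)
suff H i' : l <= 2 ^ i' ->
    left_tail (block i') l = drop 1 (rcons (nseq l ly) lx) /\
    right_tail (block i') l = nseq l ly.
  by move=> /H[-> ->] /H[-> ->].
case: l => [|l] hl; first by rewrite /left_tail /right_tail.
have hb : size (block i') = (2 ^ i').+1 by rewrite size_block.
have Eb : wpow (block i') 1 = block i' by rewrite /wpow /= cats0.
split.
  have /suffixP[s Es] :
      suffix (rcons (nseq l ly) lx) (left_tail (block i') l.+1).
    apply: (@suffix_left_tail _ _ _ 1); rewrite ?hb ?size_rcons ?size_nseq //.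
    rewrite Eb /block suffix_rcons eqxx /=; apply/suffixP.
    by exists (nseq (2 ^ i' - l) ly); rewrite -nseqD subnK // ltnW.
  have := size_left_tail (block i') l.+1.
  rewrite Es size_cat size_rcons size_nseq -[X in _ <= X]add0n leq_add2r leqn0.
  by move/nilP ->; rewrite /= drop0.
have /prefixP[s Es] : prefix (nseq l.+1 ly) (right_tail (block i') l.+1).
  apply: (@prefix_right_tail _ _ _ 1); rewrite ?hb ?size_nseq //.
  rewrite Eb /block -cats1; apply: prefix_catl; apply/prefixP.
  by exists (nseq (2 ^ i' - l.+1) ly); rewrite -nseqD subnKC.
have := size_right_tail (block i') l.+1.
rewrite Es size_cat size_nseq -[X in _ <= X]addn0 leq_add2l leqn0.
by move/nilP ->; rewrite cats0.
Qed.

Lemma tail_bounded l m i : l <= 2 ^ m -> exists i' : 'I_m.+1,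
  left_tail (block i) l = left_tail (block i') l /\
  right_tail (block i) l = right_tail (block i') l.
Proof.
move=> lm; case: (leqP i m) => [im|mi].
  by exists (Ordinal (im : i < m.+1)).
exists ord_max; apply: tail_stable => //.
by rewrite (leq_trans lm) // leq_exp2l // ltnW.
Qed.

(** The codes that are counted: two tails, the presence of the central word
    M between them, and the position and the length of the window. The bound
    5 l on the position comes from two tails of length l and |M| <= 3 l. *)
Definition decode l m M
    (c : 'I_m.+1 * 'I_m.+1 * bool * 'I_(5 * l).+1 * 'I_l.+1) :=
  let: (i, j, b, s, t) := c in
  take t (drop s (left_tail (block i) l ++
                  (if b then M else [::]) ++ right_tail (block j) l)).

Lemma decodeP l m M u i j c d (b : bool) S P : l <= 2 ^ m -> size M <= 3 * l ->
  suffix S (wpow (block i) c) -> prefix P (wpow (block j) d) ->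
  size S <= l -> size P <= l -> size u <= l ->
  infix u (S ++ (if b then M else [::]) ++ P) ->
  exists c, u = @decode l m M c.
Proof.
move=> lm lM hS hP lS lP lu; set N := if b then M else [::] => hu.
have lN : size N <= 3 * l by rewrite /N; case: (b).
have [i' [Ei _]] := tail_bounded i lm; have [j' [_ Ej]] := tail_bounded j lm.
have /suffixP[s Es] : suffix S (left_tail (block i') l).
  by rewrite -Ei; apply: suffix_left_tail hS lS; rewrite size_block.
have /prefixP[s' Es'] : prefix P (right_tail (block j') l).
  by rewrite -Ej; apply: prefix_right_tail hP lP; rewrite size_block.
have : infix u (left_tail (block i') l ++ N ++ right_tail (block j') l).
  apply: infix_trans hu _; rewrite Es Es'; apply/infixP; exists s, s'.
  by rewrite -!catA.
case/infixP=> p [p' E].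
have lp : size p < (5 * l).+1.
  have := congr1 size E; rewrite !size_cat.
  have := size_left_tail (block i') l.
  have := size_right_tail (block j') l; lia.
exists (i', j', b, Ordinal lp, Ordinal (lu : _ < l.+1)) => /=.
by rewrite E drop_size_cat // take_size_cat.
Qed.

Lemma ruler_lang_decode l k m u : (forall j, k <= j -> l <= size (spacer j)) ->
  size (ruler k) <= 3 * l -> l <= 2 ^ m -> size u <= l -> ruler_lang u ->
  exists c, u = @decode l m (ruler k) c.
Proof.
move=> hk lW lm lu /(ruler_lang_two_sided hk lu)[i [j [a [b]]]].
have from_pow i' a' : infix u (wpow (block i') a') ->
    exists c, u = @decode l m (ruler k) c.
  case/infix_block_pow => S [P [c [d [E hS hP]]]].
  have [lS lP] := size_cat_le E lu.
  apply: (@decodeP _ _ _ _ _ _ _ _ false S P lm lW hS hP lS lP lu).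
  by rewrite E infix_refl.
have p0 i' : prefix [::] (wpow (block i') 0) by [].
case/infix_cat_or => [/from_pow //| | [S [P [E hS]]]].
  case/infix_cat_or => [h|/from_pow //|[S [P [E hS hP]]]].
    apply: (@decodeP _ _ _ _ 0 0 0 0 true [::] [::]) => //.
    by rewrite cats0.
  have [lS lP] := size_cat_le E lu.
  apply: (@decodeP _ _ _ _ 0 j 0 b true [::] P) => //.
  by rewrite E; case/suffixP: hS => s ->; rewrite -catA suffix_infix.
have [lS lP] := size_cat_le E lu.
case/prefix_cat_or => [hP|[Q EQ hP]].
  apply: (@decodeP _ _ _ _ i 0 a 0 true S [::] lm lW hS) => //.
  by rewrite E cats0; case/prefixP: hP => s ->; rewrite catA prefix_infix.
have [_ lQ] := size_cat_le EQ lP.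
apply: (@decodeP _ _ _ _ i j a b true S Q lm lW hS hP) => //.
by rewrite E EQ infix_refl.
Qed.

(** For the least such k > 0, the spacer below it is shorter than l, and so is the
    ruler word below it: ruler k consists of three pieces shorter than l. *)
Lemma exists_scale l : 0 < l -> exists2 k,
  (forall j, k <= j -> l <= size (spacer j)) & size (ruler k) <= 3 * l.
Proof.
move=> l0; have ex : exists n, l <= size (spacer n).
  by exists l; rewrite size_spacer; have := size_ruler l; nia.
have [k hk kmin] := ex_minnP ex; exists k.
  by move=> j /size_spacer_mono; apply: leq_trans.
case: k hk kmin => [|k] _ kmin; first by rewrite /=; lia.
have lt : size (spacer k) < l.
  by rewrite ltnNge; apply/negP => /kmin; rewrite ltnn.
have le : size (ruler k) <= l.
  by apply: leq_trans (ltnW lt); rewrite size_spacer leq_pmulr.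
by rewrite rulerS !size_cat !mulSn mul0n addn0 !leq_add // ltnW.
Qed.

Lemma ruler_lang_upper l : 0 < l -> exists2 s : seq (seq 'I_2),
  size s <= 2 * (trunc_log 2 l).+2 ^ 2 * (5 * l).+1 * l.+1 &
  forall u, ruler_lang u -> size u <= l -> u \in s.
Proof.
move=> l0; have [k hk lW] := exists_scale l0.
have lm : l <= 2 ^ (trunc_log 2 l).+1 by apply/ltnW/trunc_log_ltn.
exists (codom (@decode l (trunc_log 2 l).+1 (ruler k))).
  rewrite size_codom !card_prod !card_ord card_bool; lia.
move=> u Lu lu; have [c ->] := ruler_lang_decode hk lW lm lu Lu.
exact: codom_f.
Qed.

End Combinatorics.

(** * Dimensions of subspaces *)

Section LinearAlgebra.
Local Open Scope classical_set_scope.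
Local Open Scope ring_scope.
Variables (k : fieldType) (A : lmodType k).
Implicit Types (X V : set A) (s t : seq A).

Definition is_subspace V :=
  V 0 /\ forall (c : k) u v, V u -> V v -> V (c *: u + v).

Lemma is_subspaceZ V c u : is_subspace V -> V u -> V (c *: u).
Proof. by case=> V0 VL Vu; rewrite -[_ *: _]addr0; exact: VL. Qed.

Lemma is_subspaceD V u v : is_subspace V -> V u -> V v -> V (u + v).
Proof. by case=> _ VL Vu Vv; rewrite -[u]scale1r; exact: VL. Qed.

Lemma is_subspace_sum V (I : Type) (r : seq I) (P : pred I) (F : I -> A) :
  is_subspace V -> (forall i, P i -> V (F i)) -> V (\sum_(i <- r | P i) F i).
Proof.
move=> hV hF; apply: big_ind => //; first by case: hV.
by move=> u v; exact: is_subspaceD.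
Qed.

Lemma lin_span_min X V : is_subspace V -> X `<=` V -> lin_span X `<=` V.
Proof.
move=> hV XV _ [n [c [x [hx ->]]]]; apply: is_subspace_sum => // i _.
by apply: is_subspaceZ => //; apply: XV.
Qed.

Lemma lin_span_seqP X a : lin_span X a <->
  exists2 r : seq (k * A), (forall p, p \in r -> X p.2) &
    a = \sum_(p <- r) p.1 *: p.2.
Proof.
split=> [[n [c [x [hx ->]]]]|[r hr ->]].
  exists [seq (c i, x i) | i <- enum 'I_n]; last by rewrite big_map big_enum.
  by move=> p /mapP[i _ ->]; exact: hx.
exists (size r), (fun i => (nth (0, 0) r i).1), (fun i => (nth (0, 0) r i).2).
by split=> [i|]; [apply/hr/mem_nth | rewrite (big_nth (0, 0)) big_mkord].
Qed.

Lemma sub_lin_span X : X `<=` lin_span X.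
Proof.
move=> a Xa; apply/lin_span_seqP; exists [:: (1, a)].
  by move=> p; rewrite inE => /eqP ->.
by rewrite big_seq1 scale1r.
Qed.

Lemma lin_span_subspace X : is_subspace (lin_span X).
Proof.
split; first by apply/lin_span_seqP; exists [::]; rewrite ?big_nil.
move=> c u v /lin_span_seqP[r hr ->] /lin_span_seqP[r' hr' ->].
apply/lin_span_seqP; exists ([seq (c * p.1, p.2) | p <- r] ++ r').
  by move=> p; rewrite mem_cat => /orP[/mapP[q /hr hq ->]|/hr'].
rewrite big_cat big_map scaler_sumr; congr (_ + _).
by apply: eq_bigr => p _; rewrite scalerA.
Qed.

Lemma lin_span_seqE t a : lin_span [set` t] a ->
  exists c : 'I_(size t) -> k, a = \sum_i c i *: t`_i.
Proof.
pose V : set A := [set a | exists c : 'I_(size t) -> k, a = \sum_i c i *: t`_i].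
apply: (@lin_span_min _ V); first split.
- by exists (fun=> 0); rewrite big1 // => i _; rewrite scale0r.
- move=> c u v [d ->] [e ->]; exists (fun i => c * d i + e i).
  rewrite scaler_sumr -big_split; apply: eq_bigr => i _ /=.
  by rewrite scalerA scalerDl.
- move=> b /= tb; have lt : (index b t < size t)%N by rewrite index_mem.
  exists (fun i => (i == Ordinal lt)%:R).
  rewrite (bigD1 (Ordinal lt)) //= eqxx scale1r.
  rewrite nth_index // big1 ?addr0 // => i /negbTE ->; exact: scale0r.
Qed.

(** If s were longer than t, the matrix of the coordinates of s on t would have
    a nonzero row kernel, which is a relation between the vectors of s. *)
Lemma steinitz s t : lin_indep s ->
  (forall a, a \in s -> lin_span [set` t] a) -> (size s <= size t)%N.
Proof.
move=> indep hs; rewrite leqNgt; apply/negP => lt.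
have /choice[M hM] : forall i : 'I_(size s), exists c : 'I_(size t) -> k,
    s`_i = \sum_j c j *: t`_j.
  by move=> i; apply/lin_span_seqE/hs/mem_nth.
pose B := \matrix_(i, j) M i j.
have /rowV0Pn[v /sub_kermxP vB nz] : kermx B != 0.
  rewrite -mxrank_eq0 mxrank_ker subn_eq0 -ltnNge.
  exact: leq_ltn_trans (rank_leq_col _) lt.
case/negP: nz; apply/eqP/rowP => i; rewrite mxE.
apply: (indep (fun i => v 0 i)); under eq_bigr => j _ do rewrite hM scaler_sumr.
rewrite exchange_big big1 //= => j _.
have /rowP/(_ j) := vB; rewrite !mxE => e.
rewrite -[RHS](scale0r t`_j) -e scaler_suml; apply: eq_bigr => l _.
by rewrite mxE scalerA.
Qed.

Lemma lin_indep_cons a s :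
  lin_indep s -> ~ lin_span [set` s] a -> lin_indep (a :: s).
Proof.
move=> indep na c; rewrite big_ord_recl /= => e.
have c0 : c ord0 = 0.
  apply: contrapT => /eqP nz; apply: na.
  have -> : a = - (c ord0)^-1 *: \sum_(i < size s) c (lift ord0 i) *: s`_i.
    rewrite scaleNr -scalerN; move/eqP: e; rewrite addr_eq0 => /eqP <-.
    by rewrite scalerA mulVf ?scale1r.
  apply: is_subspaceZ (lin_span_subspace _) _.
  apply: is_subspace_sum (lin_span_subspace _) _ => i _.
  apply: is_subspaceZ (lin_span_subspace _) _.
  by apply: sub_lin_span; apply: mem_nth.
move: e; rewrite c0 scale0r add0r => /(indep (fun i => c (lift ord0 i))) h i.
by case: (unliftP ord0 i) => [j ->|->].
Qed.

(** An independent sequence in V of maximal length; lengths are bounded by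
    that of t. *)
Lemma basis_exists V t : is_subspace V -> V `<=` lin_span [set` t] ->
  exists s, lin_indep s /\ V = lin_span [set` s].
Proof.
move=> hV Vt.
pose P n :=
  `[< exists s, [/\ size s = n, lin_indep s & forall a, a \in s -> V a] >].
have P0 : exists n, P n.
  by exists 0%N; apply/asboolP; exists [::]; split=> // c _ [].
have Pb n : P n -> (n <= size t)%N.
  by move=> /asboolP[s [<- indep hs]]; apply: steinitz => // a /hs /Vt.
have [n /asboolP[s [Es indep hs]] nmax] := ex_maxnP P0 Pb.
exists s; split=> //; apply/seteqP; split; last by apply: lin_span_min.
move=> a Va; apply: contrapT => /(lin_indep_cons indep) indep'.
suff /nmax : P n.+1 by rewrite ltnn.
apply/asboolP; exists (a :: s); split; rewrite /= ?Es // => b.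
by rewrite inE => /orP[/eqP ->|/hs].
Qed.

Lemma subspace_dimP V t : is_subspace V -> V `<=` lin_span [set` t] ->
  exists s, [/\ size s = subspace_dim V, lin_indep s & V = lin_span [set` s]].
Proof.
move=> hV Vt; rewrite /subspace_dim; have [s [si sV]] := basis_exists hV Vt.
by case: xgetP => [n -> //|/(_ (size s))]; case; exists s.
Qed.

Lemma subspace_dim_le V t : is_subspace V -> V `<=` lin_span [set` t] ->
  (subspace_dim V <= size t)%N.
Proof.
move=> hV Vt; have [s [<- si sV]] := subspace_dimP hV Vt.
apply: steinitz => // a sa; apply: Vt; rewrite sV; exact: sub_lin_span.
Qed.

Lemma subspace_dim_ge V t u : is_subspace V -> V `<=` lin_span [set` t] ->
  lin_indep u -> (forall a, a \in u -> V a) -> (size u <= subspace_dim V)%N.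
Proof.
move=> hV Vt ui uV; have [s [<- si sV]] := subspace_dimP hV Vt.
by apply: steinitz => // a /uV; rewrite sV.
Qed.

End LinearAlgebra.

(** * The monomial algebra of a language *)

(** The relation t (s p * s' q) = t (p * q) is linear in p and in q, so it can
    be checked on the elements g i, if every element is reached from these
    by linear combinations. The hypothesis on scalars makes up for the left
    algebra structure, where they commute only with the left factor. *)
Lemma bilinear_ext (k : fieldType) (R : lalgType k) (I : Type) (g : I -> R)
    (scalerAr : forall (c : k) (p q : R), (c *: (p * q) = p * (c *: q))%R)
    (ind : forall P : R -> Prop, (forall i, P (g i)) -> P 0%R ->
      (forall (c : k) p q, P p -> P q -> P (c *: p + q)%R) -> forall p, P p)
    (t s s' : {linear R -> R}) :
  (forall i j, t (s (g i) * s' (g j)) = t (g i * g j))%R ->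
  forall p q, t (s p * s' q)%R = t (p * q)%R.
Proof.
move=> tg p q; elim/ind: p => [i||c p p' IH IH'].
- elim/ind: q => [j||c q q' IH IH'].
  + exact: tg.
  + by rewrite linear0 !mulr0.
  + by rewrite linearP !mulrDr -!scalerAr !linearP IH IH'.
- by rewrite linear0 !mul0r.
- by rewrite linearP !mulrDl -!scalerAl !linearP IH IH'.
Qed.

Section FreeAlgebra.
Local Open Scope ring_scope.
Variables (k : fieldType) (d : nat).
Local Notation F := (free_algebra k d).
Local Notation monomial := (@monomial k d).
Implicit Types (p q r : F) (u v w : word d).

Lemma mcoeff_monomial u w : mcoeff w (monomial u) = (u == w)%:R.
Proof. exact: mcoeffU1. Qed.

Lemma monomialM u v : monomial (u ++ v) = monomial u * monomial v.
Proof. by rewrite malgM_def fgmulUU mulr1. Qed.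

Lemma monomial_nil : monomial [::] = 1. Proof. by []. Qed.

Lemma free_expand p : p = \sum_(w <- msupp p) mcoeff w p *: monomial w.
Proof.
rewrite {1}[p]monalgE; apply: eq_bigr => w _.
by apply/malgP => v; rewrite mcoeffZ mcoeff_monomial mcoeffU mulr_natr.
Qed.

Lemma free_scalerAr (c : k) p q : c *: (p * q) = p * (c *: q).
Proof.
apply/malgP => w; rewrite mcoeffZ mcoeffMl.
(* Both sums must run over the same words, although c may be 0. *)
rewrite (mcoeffMlw _ (fsubset_refl _) (msuppZ_le c q)).
rewrite mulr_sumr; apply: eq_bigr => u _.
rewrite mulr_sumr; apply: eq_bigr => v _.
by rewrite mcoeffZ mulrnAr mulrCA.
Qed.

Lemma free_ind (P : F -> Prop) : (forall w, P (monomial w)) -> P 0 ->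
  (forall c p q, P p -> P q -> P (c *: p + q)) -> forall p, P p.
Proof.
move=> Pw P0 PL p; rewrite [p]free_expand; apply: big_ind => //.
  by move=> p1 p2 P1 P2; rewrite -[p1]scale1r; exact: PL.
by move=> w _; rewrite -[_ *: _]addr0; exact: PL.
Qed.

End FreeAlgebra.

Record language (d : nat) := Language {
  lang :> word d -> Prop;
  lang_nil : lang [::];
  lang_infix : forall u v, infix u v -> lang v -> lang u }.

Section Truncation.
Local Open Scope ring_scope.
Variables (k : fieldType) (d : nat) (L : language d).
Local Notation F := (free_algebra k d).
Local Notation monomial := (@monomial k d).
Implicit Types (p q r : F) (u v w : word d).

Lemma lang_catl u v : L (u ++ v) -> L u.
Proof. exact/lang_infix/prefix_infix. Qed.

Lemma lang_catr u v : L (u ++ v) -> L v.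
Proof. exact/lang_infix/suffix_infix. Qed.

(** The linear projection of the free algebra onto the span of the words in L,
    along the ideal spanned by the other words. *)
Definition truncate p : F :=
  \sum_(w <- msupp p | `[< L w >]) mcoeff w p *: monomial w.

Lemma mcoeff_truncate p v :
  mcoeff v (truncate p) = if `[< L v >] then mcoeff v p else 0.
Proof.
rewrite raddf_sum /=; case: ifPn => Lv; last first.
  rewrite big1 // => w Lw; rewrite mcoeffZ mcoeff_monomial.
  by case: eqP => [E|]; rewrite ?mulr0 //; rewrite E (negbTE Lv) in Lw.
rewrite [in RHS](free_expand p) raddf_sum /= big_mkcond; apply: eq_bigr => w _.
case: ifPn => // Lw; rewrite mcoeffZ mcoeff_monomial.
by case: eqP => [E|]; rewrite ?mulr0 //; rewrite E Lv in Lw.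
Qed.

Lemma truncate_is_linear : linear truncate.
Proof.
move=> c p q; apply/malgP => w; rewrite mcoeffD mcoeffZ !mcoeff_truncate.
by rewrite mcoeffD mcoeffZ; case: ifP => // _; rewrite mulr0 addr0.
Qed.
HB.instance Definition _ :=
  GRing.isLinear.Build k F F *:%R truncate truncate_is_linear.

Lemma truncate0 : truncate 0 = 0. Proof. exact: linear0. Qed.

Lemma truncateD p q : truncate (p + q) = truncate p + truncate q.
Proof. exact: linearD. Qed.

Lemma truncateZ c p : truncate (c *: p) = c *: truncate p.
Proof. exact: linearZ. Qed.

Lemma truncate_monomial w :
  truncate (monomial w) = if `[< L w >] then monomial w else 0.
Proof.
apply/malgP => v; rewrite mcoeff_truncate mcoeff_monomial.
case: (eqVneq w v) => [->|/negbTE ne].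
  by case: ifP => _; rewrite ?mcoeff0 // mcoeff_monomial eqxx.
by case: ifP => _; case: ifP => _; rewrite ?mcoeff0 // mcoeff_monomial ne.
Qed.

Lemma truncate_id p : truncate (truncate p) = truncate p.
Proof.
by apply/malgP => w; rewrite !mcoeff_truncate; case: `[< _ >].
Qed.

(** Since L is closed under factors, a word outside L stays outside when it is
    multiplied: the kernel of the truncation is an ideal. *)
Lemma truncateM p q : truncate (truncate p * truncate q) = truncate (p * q).
Proof.
move: p q; apply: (bilinear_ext (@free_scalerAr k d) (@free_ind k d)) => u v /=.
have [Luv|nLuv] := pselect (L (u ++ v)).
  congr (truncate (_ * _)); rewrite truncate_monomial asboolT //.
    exact: lang_catl Luv.
  exact: lang_catr Luv.
transitivity (0 : F); last by rewrite -monomialM truncate_monomial asboolF.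
rewrite !truncate_monomial; case: ifPn => _; last by rewrite mul0r truncate0.
case: ifPn => _; last by rewrite mulr0 truncate0.
by rewrite -monomialM truncate_monomial asboolF.
Qed.

Lemma truncateMl p q : truncate (truncate p * q) = truncate (p * q).
Proof. by rewrite -[LHS]truncateM truncate_id truncateM. Qed.

Lemma truncateMr p q : truncate (p * truncate q) = truncate (p * q).
Proof. by rewrite -[LHS]truncateM truncate_id truncateM. Qed.

Definition in_lang : {pred F} := [pred p | truncate p == p].

Lemma in_lang_submod : submod_closed in_lang.
Proof.
split; first by rewrite inE truncate0.
by move=> c p q; rewrite !inE truncateD truncateZ => /eqP -> /eqP ->.
Qed.
HB.instance Definition _ :=
  GRing.isSubmodClosed.Build k F in_lang in_lang_submod.

(** The quotient of the free algebra is realized on normal forms, which makes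
    the words in L a basis by construction; products are truncated. *)
Record mon_alg := MonAlg { mon_val : F; _ : mon_val \in in_lang }.
HB.instance Definition _ := [isSub for mon_val].
HB.instance Definition _ := [Choice of mon_alg by <:].
HB.instance Definition _ := [SubChoice_isSubLmodule of mon_alg by <:].

Lemma truncate_in p : truncate p \in in_lang.
Proof. by rewrite inE truncate_id. Qed.

Definition mon_proj p : mon_alg := MonAlg (truncate_in p).

Lemma val_proj p : val (mon_proj p) = truncate p. Proof. by []. Qed.

Lemma mon_valK (a : mon_alg) : truncate (val a) = val a.
Proof. by apply/eqP; case: a. Qed.

Definition mon_mul (a b : mon_alg) := mon_proj (val a * val b).
Definition mon_one := mon_proj 1.

Lemma mon_mulA : associative mon_mul.
Proof.
by move=> a b c; apply/val_inj; rewrite /= truncateMl truncateMr mulrA.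
Qed.

Lemma mon_mul1l : left_id mon_one mon_mul.
Proof. by move=> a; apply/val_inj; rewrite /= truncateMl mul1r mon_valK. Qed.

Lemma mon_mul1r : right_id mon_one mon_mul.
Proof. by move=> a; apply/val_inj; rewrite /= truncateMr mulr1 mon_valK. Qed.

Lemma mon_mulDl : left_distributive mon_mul +%R.
Proof. by move=> a b c; apply/val_inj; rewrite /= mulrDl truncateD. Qed.

Lemma mon_mulDr : right_distributive mon_mul +%R.
Proof. by move=> a b c; apply/val_inj; rewrite /= mulrDr truncateD. Qed.

Lemma mon_one_neq0 : mon_one != 0.
Proof.
apply/eqP => /(congr1 val)/malgP/(_ [::]).
rewrite /= mcoeff_truncate asboolT; last exact: lang_nil.
rewrite mcoeff0 -monomial_nil mcoeff_monomial eqxx; move/eqP.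
exact/negP/oner_neq0.
Qed.

HB.instance Definition _ := GRing.Zmodule_isNzRing.Build mon_alg
  mon_mulA mon_mul1l mon_mul1r mon_mulDl mon_mulDr mon_one_neq0.

Lemma mon_scalerAl (c : k) (a b : mon_alg) : c *: (a * b) = c *: a * b.
Proof. by apply/val_inj; rewrite /= -scalerAl truncateZ. Qed.
HB.instance Definition _ :=
  GRing.Lmodule_isLalgebra.Build k mon_alg mon_scalerAl.

Lemma mon_scalerAr (c : k) (a b : mon_alg) : c *: (a * b) = a * (c *: b).
Proof. by apply/val_inj; rewrite /= -free_scalerAr truncateZ. Qed.
HB.instance Definition _ :=
  GRing.Lalgebra_isAlgebra.Build k mon_alg mon_scalerAr.

Lemma mon_proj_linear : linear mon_proj.
Proof. by move=> c p q; apply/val_inj; rewrite /= truncateD truncateZ. Qed.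
HB.instance Definition _ :=
  GRing.isLinear.Build k F mon_alg *:%R mon_proj mon_proj_linear.

Lemma mon_proj_monoid : monoid_morphism mon_proj.
Proof.
by split=> // p q; apply/val_inj; rewrite /= truncateMl truncateMr.
Qed.
HB.instance Definition _ :=
  GRing.isMonoidMorphism.Build F mon_alg mon_proj mon_proj_monoid.

Lemma mon_projK (a : mon_alg) : mon_proj (val a) = a.
Proof. by apply/val_inj; rewrite /= mon_valK. Qed.

(** An element with truncation 0 is the combination of its own words, which
    are all outside L; this writes it as a member of the ideal. *)
Lemma mon_algP : monomial_algebra mon_alg.
Proof.
exists d, [set w | ~ L w]%classic, mon_proj; split.
  by move=> a; exists (val a); exact: mon_projK.
move=> p; split=> [/(congr1 val)/= p0|[n [a [x [b [hx ->]]]]]].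
  pose s := [seq w <- msupp p | ~~ `[< L w >]].
  exists (size s), (fun i => (mcoeff (nth [::] s i) p)%:A),
    (fun i => monomial (nth [::] s i)), (fun=> 1); split.
    move=> i /=; exists (nth [::] s i) => //.
    by have := mem_nth [::] (ltn_ord i); rewrite mem_filter => /andP[/asboolPn].
  under eq_bigr => i _ do rewrite mulr1 -scalerAl mul1r.
  pose f w := mcoeff w p *: monomial w.
  rewrite -(big_mkord xpredT (fun i => f (nth [::] s i))).
  rewrite -(big_nth [::] xpredT f) big_filter {1}[p]free_expand.
  by rewrite (bigID (fun w => `[< L w >])) /= -/(truncate p) p0 add0r.
rewrite raddf_sum big1 //= => i _; have [w /= nLw E] := hx i.
have x0 : mon_proj (x i) = 0.
  by apply/val_inj; rewrite /= -E truncate_monomial asboolF.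
by rewrite !rmorphM /= x0 mulr0 mul0r.
Qed.

End Truncation.

(** * Powers of a frame *)

Section SubspacePowers.
Local Open Scope classical_set_scope.
Local Open Scope ring_scope.
Variables (k : fieldType) (A : algType k) (V : set A).

Local Notation "V ^*^ n" := (subspace_exp V n) (at level 30).

Lemma is_subspace_mulr (U : set A) b :
  is_subspace U -> is_subspace [set a | U (a * b)].
Proof.
case=> U0 UL; split=> [|c u v Uu Uv] /=; first by rewrite mul0r.
by rewrite mulrDl -scalerAl; exact: UL.
Qed.

Lemma is_subspace_mull (U : set A) a :
  is_subspace U -> is_subspace [set b | U (a * b)].
Proof.
case=> U0 UL; split=> [|c u v Uu Uv] /=; first by rewrite mulr0.
by rewrite mulrDr -scalerAr; exact: UL.
Qed.

Lemma subspace_exp_subspace n : is_subspace (V ^*^ n).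
Proof. exact: lin_span_subspace. Qed.

Lemma subspace_expD n m a b :
  (V ^*^ n) a -> (V ^*^ m) b -> (V ^*^ (n + m)) (a * b).
Proof.
move=> ha hb.
apply: (lin_span_min (is_subspace_mulr b (subspace_exp_subspace _)) _ ha).
move=> _ [v hv <-] /=.
apply: (lin_span_min (is_subspace_mull _ (subspace_exp_subspace _)) _ hb).
move=> _ [w hw <-] /=; apply: sub_lin_span.
exists (fun i : 'I_(n + m) =>
    match fintype.split i with inl j => v j | inr j => w j end).
  by move=> i /=; case: fintype.split.
rewrite big_split_ord /=; congr (_ * _); apply: eq_bigr => i _.
  by rewrite -[lshift _ _]/(unsplit (inl i)) unsplitK.
by rewrite -[rshift _ _]/(unsplit (inr i)) unsplitK.
Qed.

Hypothesis V1 : V 1.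

Lemma subspace_exp1 n : (V ^*^ n) 1.
Proof. by apply: sub_lin_span; exists (fun=> 1); rewrite //= big1. Qed.

Lemma subspace_exp_mono n m a : (n <= m)%N -> (V ^*^ n) a -> (V ^*^ m) a.
Proof.
move=> /subnKC <- ha; rewrite -[a]mulr1.
exact: subspace_expD ha (subspace_exp1 _).
Qed.

(** The union of the powers of V is a subalgebra that contains V. *)
Lemma generates_subspace_exp a : generates V -> exists n, (V ^*^ n) a.
Proof.
move=> gV; pose S : {pred A} := fun a => `[< exists n, (V ^*^ n) a >].
have SP b : reflect (exists n, (V ^*^ n) b) (b \in S) by exact: asboolP.
apply/SP; apply: gV => [|v Vv]; last first.
  apply/SP; exists 1%N; apply: sub_lin_span.
  by exists (fun=> v); rewrite //= big_ord1.
split.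
- by apply/SP; exists 0%N; exact: subspace_exp1.
- move=> c u v /SP[n hn] /SP[m hm].
  apply/SP; exists (maxn n m); apply: (subspace_exp_subspace _).2.
    exact: subspace_exp_mono (leq_maxl _ _) hn.
  exact: subspace_exp_mono (leq_maxr _ _) hm.
- move=> u v /SP[n hn] /SP[m hm].
  by apply/SP; exists (n + m)%N; exact: subspace_expD.
Qed.

End SubspacePowers.

(** * Degree, bases and primeness of monomial algebras *)

Lemma sum_sandwich (k : fieldType) (R : lalgType k)
    (scalerAr : forall (c : k) (p q : R), (c *: (p * q) = p * (c *: q))%R)
    (I J : Type) (r : seq I) (s : seq J) (c : I -> k) (e : J -> k)
    (x : I -> R) (y : J -> R) (m : R) :
  ((\sum_(i <- r) c i *: x i) * m * (\sum_(j <- s) e j *: y j) =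
    \sum_(i <- r) \sum_(j <- s) (c i * e j) *: (x i * m * y j))%R.
Proof.
rewrite !mulr_suml; apply: eq_bigr => i _.
rewrite mulr_sumr; apply: eq_bigr => j _.
by rewrite -scalerAr -!scalerAl scalerA mulrC.
Qed.

Section MonomialAlgebraTheory.
Local Open Scope classical_set_scope.
Local Open Scope ring_scope.
Variables (k : fieldType) (d : nat) (L : language d).
Local Notation A := (@mon_alg k d L).
Implicit Types (a b : A) (u v w : word d).

Definition mon_word w : A := mon_proj L (monomial k w).

Lemma mon_wordM u v : mon_word (u ++ v) = mon_word u * mon_word v.
Proof. by rewrite /mon_word monomialM rmorphM. Qed.

Lemma mon_word_nil : mon_word [::] = 1. Proof. exact: rmorph1. Qed.

Lemma mcoeff_mon_word w v : L w -> mcoeff v (val (mon_word w)) = (w == v)%:R.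
Proof.
by move=> Lw; rewrite /= truncate_monomial asboolT // mcoeff_monomial.
Qed.

Lemma mon_word_out w : ~ L w -> mon_word w = 0.
Proof. by move=> Lw; apply/val_inj; rewrite /= truncate_monomial asboolF. Qed.

Lemma mcoeff_out a w : ~ L w -> mcoeff w (val a) = 0.
Proof. by move=> nLw; rewrite -mon_valK mcoeff_truncate asboolF. Qed.

Lemma mon_expand a :
  a = \sum_(w <- msupp (val a)) mcoeff w (val a) *: mon_word w.
Proof.
rewrite -[LHS]mon_projK [X in mon_proj _ X]free_expand linear_sum.
by apply: eq_bigr => w _; rewrite linearZ.
Qed.

Definition deg_le m : set A :=
  [set a | forall w, mcoeff w (val a) != 0 -> (size w <= m)%N].

Lemma deg_le_subspace m : is_subspace (deg_le m).
Proof.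
split=> [w|c u v hu hv w]; first by rewrite /= mcoeff0 eqxx.
rewrite /= mcoeffD mcoeffZ => nz.
case: (eqVneq (mcoeff w (val u)) 0) => [e|/hu //].
by apply: hv; move: nz; rewrite e mulr0 add0r.
Qed.

Lemma deg_le_mono m n a : (m <= n)%N -> deg_le m a -> deg_le n a.
Proof. by move=> mn h w /h /leq_trans; exact. Qed.

Lemma deg_le_exists a : exists m, deg_le m a.
Proof.
exists (\max_(w <- msupp (val a)) size w)%N => w; rewrite mcoeff_neq0 => hw.
exact: (@leq_bigmax_seq _ _ xpredT).
Qed.

Lemma deg_le_word w m : (size w <= m)%N -> deg_le m (mon_word w).
Proof.
move=> hw v; have [Lw|nLw] := pselect (L w).
  rewrite mcoeff_mon_word //; case: (eqVneq w v) => [<- //|_].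
  by rewrite mulr0n eqxx.
by rewrite mon_word_out //= mcoeff0 eqxx.
Qed.

Lemma deg_le_ind (U : set A) m : is_subspace U ->
  (forall w, L w -> (size w <= m)%N -> U (mon_word w)) -> deg_le m `<=` U.
Proof.
move=> hU hw a ha.
rewrite [a]mon_expand big_seq; apply: is_subspace_sum => // w.
rewrite -mcoeff_neq0 => nz; apply: is_subspaceZ => //.
apply: hw (ha _ nz); apply: contrapT => /(mcoeff_out a)/eqP; exact/negP.
Qed.

Lemma deg_leM m n a b : deg_le m a -> deg_le n b -> deg_le (m + n) (a * b).
Proof.
move=> ha hb; have hU := deg_le_subspace (m + n).
apply: (deg_le_ind (is_subspace_mulr b hU) _ ha) => u _ hu /=.
apply: (deg_le_ind (is_subspace_mull (mon_word u) hU) _ hb).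
move=> v _ hv /=; rewrite -mon_wordM; apply: deg_le_word.
by rewrite size_cat leq_add.
Qed.

Lemma deg_le_prod m n (v : 'I_n -> A) : (forall i, deg_le m (v i)) ->
  deg_le (m * n) (\prod_(i < n) v i).
Proof.
elim: n v => [|n IH] v hv.
  by rewrite big_ord0 -mon_word_nil; exact: deg_le_word.
by rewrite big_ord_recl mulnS; apply: deg_leM => //; apply: IH.
Qed.

Lemma word_span m (s : seq (word d)) :
  (forall w, L w -> (size w <= m)%N -> w \in s) ->
  deg_le m `<=` lin_span [set` map mon_word s].
Proof.
move=> hs; apply: deg_le_ind; first exact: lin_span_subspace.
by move=> w Lw hw; apply: sub_lin_span; apply/map_f/hs.
Qed.

Lemma word_indep (s : seq (word d)) : uniq s -> (forall w, w \in s -> L w) ->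
  lin_indep (map mon_word s).
Proof.
move=> us sL c; move=> /(congr1 val) e i.
have hi : (i < size s)%N by rewrite -(size_map mon_word).
have := congr1 (mcoeff (nth [::] s i)) e.
rewrite mcoeff0 => <-.
rewrite linear_sum raddf_sum (bigD1 i) //= mcoeffZ.
rewrite (nth_map [::]) // mcoeff_mon_word ?eqxx ?mulr1; last exact/sL/mem_nth.
rewrite big1 ?addr0 // => j ji.
have hj : (j < size s)%N by rewrite -(size_map mon_word).
rewrite mcoeffZ (nth_map [::]) // mcoeff_mon_word; last exact/sL/mem_nth.
by rewrite nth_uniq // (inj_eq val_inj) (negbTE ji) mulr0.
Qed.

Lemma mon_generated (S : {pred A}) : GRing.subalg_closed S ->
  (forall i, mon_word [:: i] \in S) -> forall a, a \in S.
Proof.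
move=> [S1 SL SM] hi a; have hw w : mon_word w \in S.
  elim: w => [|i w IH]; first by rewrite mon_word_nil.
  by rewrite -cat1s mon_wordM; exact: (SM _ _ (hi i) IH).
have S0 : 0 \in S by rewrite -(addNr 1) -scaleN1r; exact: SL.
rewrite [a]mon_expand; apply: (big_ind (fun z => z \in S)) => //.
  by move=> u v uS vS; have := SL 1 u v uS vS; rewrite scale1r.
by move=> w _; have := SL (mcoeff w (val a)) _ _ (hw w) S0; rewrite addr0.
Qed.

Lemma mon_finitely_generated : finitely_generated A.
Proof.
exists [seq mon_word [:: i] | i <- enum 'I_d] => S cS hS a.
apply: mon_generated => // i; apply: hS; apply/mapP; exists i => //.
by rewrite mem_enum.
Qed.

Lemma leading_word (p : free_algebra k d) : p != 0 ->
  exists2 u, mcoeff u p != 0 &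
    forall v, mcoeff v p != 0 -> (size v <= size u)%N.
Proof.
move=> nz; pose P n := has (fun w => size w == n) (msupp p).
have exP : exists n, P n.
  apply/not_existsP => h; case/eqP: nz; apply/malgP => w; rewrite mcoeff0.
  apply/eqP; rewrite mcoeff_eq0; apply/negP => hw; apply: (h (size w)).
  by apply/hasP; exists w.
have bP n : P n -> (n <= \max_(w <- msupp p) size w)%N.
  by case/hasP => w hw /eqP <-; apply: (@leq_bigmax_seq _ _ xpredT).
have [n /hasP[u hu /eqP <-] nmax] := ex_maxnP exP bP.
exists u; first by rewrite mcoeff_neq0.
by move=> v; rewrite mcoeff_neq0 => hv; apply: nmax; apply/hasP; exists v.
Qed.

(** If u' w v' = u w v with u' not longer than u and v' not longer than v, then
    the lengths agree, and hence u' = u and v' = v: only one product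
    contributes to this coefficient. *)
Lemma mcoeff_sandwich (p q : free_algebra k d) u v w :
  (forall u', mcoeff u' p != 0 -> (size u' <= size u)%N) ->
  (forall v', mcoeff v' q != 0 -> (size v' <= size v)%N) ->
  mcoeff (u ++ w ++ v) (p * monomial k w * q) = mcoeff u p * mcoeff v q.
Proof.
move=> hu hv.
have sel (r : free_algebra k d) t :
    mcoeff t r = \sum_(t' <- msupp r) mcoeff t' r * (t' == t)%:R.
  rewrite {1}[r]free_expand raddf_sum; apply: eq_bigr => t' _.
  by rewrite /= mcoeffZ mcoeff_monomial.
have -> : p * monomial k w * q =
    (\sum_(u' <- msupp p) mcoeff u' p *: monomial k u') * monomial k w *
    (\sum_(v' <- msupp q) mcoeff v' q *: monomial k v').
  by rewrite -!free_expand.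
rewrite (sum_sandwich (@free_scalerAr k d)) raddf_sum (sel p u) (sel q v).
rewrite big_distrl big_seq [RHS]big_seq; apply: eq_bigr => u' hu' /=.
rewrite raddf_sum big_distrr big_seq [RHS]big_seq.
apply: eq_bigr => v' hv' /=.
rewrite mcoeffZ -!monomialM mcoeff_monomial -catA mulrACA; congr (_ * _).
rewrite -natrM mulnb; congr (_%:R); congr nat_of_bool.
apply/eqP/andP => [e|[/eqP -> /eqP ->] //].
have le1 : (size u' <= size u)%N by apply: hu; rewrite mcoeff_neq0.
have le2 : (size v' <= size v)%N by apply: hv; rewrite mcoeff_neq0.
have es : size u' = size u by have := congr1 size e; rewrite !size_cat; lia.
move/eqP: e; rewrite eqseq_cat // => /andP[/eqP -> /eqP e]; split=> //.
by move/eqP: e; rewrite eqseq_cat // => /andP[_ /eqP ->].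
Qed.

Lemma mon_prime : (forall u v, L u -> L v -> exists w, L (u ++ w ++ v)) ->
  prime_ring A.
Proof.
move=> Lp a b ab; apply: contrapT => /not_orP[na nb].
have val_neq0 c : c <> 0 -> val (c : A) != 0.
  by move=> nc; apply/eqP => c0; apply: nc; apply/val_inj.
have [u nu hu] := leading_word (val_neq0 _ na).
have [v nv hv] := leading_word (val_neq0 _ nb).
have Lu : L u by apply: contrapT => /(mcoeff_out a)/eqP; exact/negP.
have Lv : L v by apply: contrapT => /(mcoeff_out b)/eqP; exact/negP.
have [w Lw] := Lp _ _ Lu Lv.
have E : a * mon_word w * b = mon_proj L (val a * monomial k w * val b).
  by rewrite !rmorphM /= !mon_projK.
have z : truncate L (val a * monomial k w * val b) = 0.
  by rewrite -val_proj -E ab.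
have pq : mcoeff u (val a) * mcoeff v (val b) = 0.
  transitivity
    (mcoeff (u ++ w ++ v) (truncate L (val a * monomial k w * val b))).
    by rewrite mcoeff_truncate (asboolT Lw) (mcoeff_sandwich w hu hv).
  by rewrite z mcoeff0.
by move/eqP: pq; rewrite mulf_eq0 (negbTE nu) (negbTE nv).
Qed.

End MonomialAlgebraTheory.

(** * Full matrix algebras *)

Section MatrixAlgebra.
Local Open Scope ring_scope.
Variables (k : fieldType) (q : nat).
Local Notation Mat := 'M[k]_q.+1.

Lemma mul_delta_sandwich (A B : Mat) i j r c :
  (A * delta_mx i j * B) r c = A r i * B j c.
Proof.
rewrite !mxE (bigD1 j) //= big1 ?addr0 => [|l lj].
  rewrite !mxE (bigD1 i) //= big1 ?addr0 => [|l li].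
    by rewrite !mxE !eqxx mulr1.
  by rewrite mxE (negbTE li) mulr0.
rewrite !mxE big1 ?mul0r // => m _.
by rewrite mxE (negbTE lj) andbF mulr0.
Qed.

Lemma matrix_prime : prime_ring Mat.
Proof.
move=> a b ab; apply: contrapT => /not_orP[/eqP na /eqP nb].
have nz (m : Mat) : m != 0 -> exists i j, m i j != 0.
  move=> nm; apply: contrapT => h; case/eqP: nm; apply/matrixP => i j.
  rewrite mxE; apply/eqP; apply: contrapT => /negP mij.
  by apply: h; exists i, j.
have [i [j aij]] := nz _ na; have [r [c brc]] := nz _ nb.
have /matrixP/(_ i c) := ab (delta_mx j r).
rewrite mul_delta_sandwich mxE => /eqP.
by rewrite mulf_eq0 (negbTE aij) (negbTE brc).
Qed.

Lemma matrix_finite_dimensional : finite_dimensional Mat.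
Proof.
pose unit_mx (p : 'I_q.+1 * 'I_q.+1) : Mat := delta_mx p.1 p.2.
exists (codom unit_mx); apply/esym/seteqP; split=> // m _.
have hS := lin_span_subspace [set` codom unit_mx]%classic.
rewrite (matrix_sum_delta m); apply: (is_subspace_sum _ hS) => i _.
apply: (is_subspace_sum _ hS) => j _; apply: (is_subspaceZ _ hS).
by apply: sub_lin_span; exact: (codom_f unit_mx (i, j)).
Qed.

Definition step_mx t : Mat := delta_mx (inord t) (inord t.+1).

(** The row vector e_0 survives a product of the units E_(t, t+1) only if their
    indices are 0, 1, 2, ... in this order. *)
Lemma row_steps (g : nat -> nat) m :
  (m <= q)%N -> (forall i, (i < m)%N -> (g i <= q)%N) ->
  delta_mx 0 (inord 0) *m (\prod_(i < m) step_mx (g i)) =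
    if [forall i : 'I_m, g i == i] then delta_mx 0 (inord m) else 0
  :> 'rV[k]_q.+1.
Proof.
elim: m => [|m IH] mq hg.
  by rewrite big_ord0 mulmx1; case: forallP => [//|[]]; case.
rewrite big_ord_recr /= -[_ * step_mx _]/(_ *m step_mx _) mulmxA.
rewrite IH; [|exact: ltnW|by move=> i im; apply/hg/ltnW].
have -> : [forall i : 'I_m.+1, g i == i] =
    [forall i : 'I_m, g i == i] && (g m == m).
  apply/forallP/andP => [h|[/forallP h hm] i].
    split; last exact: (h ord_max).
    by apply/forallP => i; exact: (h (widen_ord (leqnSn m) i)).
  have := ltn_ord i; rewrite ltnS leq_eqVlt => /orP[/eqP -> //|im].
  exact: (h (Ordinal im)).
case: [forall _, _] => /=; last by rewrite mul0mx.
rewrite mul_delta_mx_cond -val_eqE /= !inordK ?ltnS ?hg ?(ltnW mq) // eq_sym.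
by case: eqP => [->|]; rewrite ?mulr1n ?mulr0n.
Qed.

(** Evaluate at E_(0,1), E_(1,2), ..., E_(n-1,n): only the identity permutation
    gives a product that does not kill e_0. *)
Lemma matrix_standard_identityN n : (n <= q)%N -> ~ standard_identity Mat n.
Proof.
move=> nq /(_ (fun t => step_mx t)).
have prodE (s : 'S_n) :
    delta_mx 0 (inord 0) *m (\prod_(i < n) step_mx (s i)) =
    if s == 1%g then delta_mx 0 (inord n) else 0 :> 'rV[k]_q.+1.
  pose g l := oapp (fun j : 'I_n => val (s j)) 0%N (insub l).
  have gE (i : 'I_n) : g i = s i by rewrite /g valK.
  have -> : \prod_(i < n) step_mx (s i) = \prod_(i < n) step_mx (g i).
    by apply: eq_bigr => i _; rewrite gE.
  rewrite row_steps // => [|i hi]; last first.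
    by rewrite (gE (Ordinal hi)); apply/ltnW/(leq_trans (ltn_ord _)).
  congr (if _ then _ else _).
  apply/forallP/eqP => [h|s1 i]; last by rewrite gE s1 perm1.
  by apply/permP => i; rewrite perm1; apply/val_inj; rewrite /= -gE; apply/eqP.
move/(congr1 (mulmx (delta_mx 0 (inord 0) : 'rV[k]_q.+1))).
rewrite mulmx0 mulmx_sumr (bigD1 1%g) //= odd_perm1 expr0 mul1r prodE eqxx big1.
  rewrite addr0 => /matrixP/(_ 0 (inord n)) /eqP.
  by rewrite !mxE !eqxx oner_eq0.
move=> s /negbTE s1; rewrite mulr_sign.
by case: ifP => _; rewrite ?mulmxN prodE s1 // oppr0.
Qed.

End MatrixAlgebra.

(** * Matrix images of the ruler algebra *)

Definition ruler_language : language 2 :=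
  Language ruler_lang_nil ruler_lang_infix.

Section MatrixImages.
Local Open Scope ring_scope.
Variables (k : fieldType) (i : nat).
Local Notation q := (2 ^ i)%N.
Local Notation Mat := 'M[k]_q.+1.

(** The positions 0, ..., 2^i of the block form a cycle; a letter moves each
    position that carries it to the next one and kills the others. *)
Definition letter_mx (a : 'I_2) : Mat :=
  if a == lx then delta_mx ord_max ord0
  else \matrix_(r, c) (c == r.+1 :> nat)%:R.

Definition word_mx (w : word 2) : Mat := \prod_(a <- w) letter_mx a.

Lemma word_mx_morphism : mmorphism word_mx.
Proof. by split=> [u v|]; rewrite /word_mx ?big_cat ?big_nil. Qed.
HB.instance Definition _ :=
  isMultiplicative.Build (word 2) Mat word_mx word_mx_morphism.

Definition eval_mx : free_algebra k 2 -> Mat :=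
  mmap (@scalar_mx k q.+1) word_mx.

Lemma eval_mx_linear : linear eval_mx.
Proof.
move=> c p r; rewrite /eval_mx mmapD mmapZ /=.
by rewrite -[_%:M * _]/(_%:M *m _) mul_scalar_mx.
Qed.
HB.instance Definition _ :=
  GRing.isLinear.Build k _ Mat *:%R eval_mx eval_mx_linear.

Lemma eval_mx_monoid : monoid_morphism eval_mx.
Proof.
have comm g (m m' : word 2) :
    GRing.comm (@scalar_mx k q.+1 (mcoeff m g)) (word_mx m').
  by rewrite /GRing.comm -[LHS]/(_%:M *m _) -[RHS]/(_ *m _%:M) scalar_mxC.
by have [hM h1] := commr_mmap_is_multiplicative comm; split.
Qed.
HB.instance Definition _ :=
  GRing.isMonoidMorphism.Build _ Mat eval_mx eval_mx_monoid.

Lemma eval_mx_monomial w : eval_mx (monomial k w) = word_mx w.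
Proof. by rewrite /eval_mx mmapU mul1r. Qed.

Definition block_tail r : word 2 := nseq (q - r) ly ++ [:: lx].

Lemma block_tail0 : block_tail 0 = block i.
Proof. by rewrite /block_tail subn0 cats1. Qed.

Lemma block_tail_max : block_tail q = [:: lx].
Proof. by rewrite /block_tail subnn. Qed.

(** A row r that the word does not kill is a position from which the word can
    be read along the periodic sequence of blocks. *)
Lemma word_mx_support w (r c : 'I_q.+1) : word_mx w r c != 0 ->
  exists m, prefix w (block_tail r ++ wpow (block i) m).
Proof.
elim: w r => [|a w IH] r; first by exists 0%N; rewrite prefix0s.
rewrite /word_mx big_cons -/(word_mx w) mxE => nz.
have {nz} [r' nz] : exists r', letter_mx a r r' * word_mx w r' c != 0.
  apply: contrapT => h; case/negP: nz; apply/eqP; rewrite big1 // => r' _.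
  by apply/eqP; apply: contrapT => /negP hr; apply: h; exists r'.
have /IH [m hm] : word_mx w r' c != 0.
  by apply: contraNneq nz => ->; rewrite mulr0.
have {nz} : letter_mx a r r' != 0.
  by apply: contraNneq nz => ->; rewrite mul0r.
rewrite /letter_mx; case: (eqVneq a lx) => [-> | na]; rewrite mxE.
  case: (eqVneq r ord_max) => [-> | _]; last by rewrite /= eqxx.
  case: (eqVneq r' ord0) => [r0 _ | _]; last by rewrite /= eqxx.
  (* Reading x at the last position starts a new block. *)
  exists m.+1; rewrite block_tail_max cat1s prefix_cons eqxx wpowS.
  by rewrite -[X in prefix _ (X ++ _)]block_tail0; move: hm; rewrite r0.
case: (eqVneq (r' : nat) r.+1) => [r'r _|_]; last by rewrite /= eqxx.
have -> : a = ly by move: na; case: a => [[|[|//]] ha] // _; apply: val_inj.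
exists m; have lt : (r < q)%N by rewrite -ltnS -r'r ltn_ord.
have -> : block_tail r = ly :: block_tail r.+1.
  by rewrite /block_tail -(subnSK lt).
by rewrite cat_cons prefix_cons eqxx -r'r.
Qed.

Lemma word_mx_lang w : word_mx w != 0 -> ruler_lang w.
Proof.
move=> nz; have [r [c rc]] : exists r c, word_mx w r c != 0.
  apply: contrapT => h; case/eqP: nz; apply/matrixP => r c; rewrite mxE.
  by apply/eqP; apply: contrapT => /negP hrc; apply: h; exists r, c.
have [m hm] := word_mx_support rc.
apply: ruler_lang_infix (ruler_lang_block_pow i m.+1).
apply: prefix_infix_trans hm _; apply/suffixW; rewrite wpowS.
apply/suffixP; exists (nseq r ly).
by rewrite /block -cats1 /block_tail !catA -nseqD subnKC // -ltnS.
Qed.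

Lemma word_mx_y a (r c : 'I_q.+1) :
  word_mx (nseq a ly) r c = (c == (r + a)%N :> nat)%:R.
Proof.
elim: a r c => [|a IH] r c; first by rewrite /word_mx big_nil mxE addn0 eq_sym.
rewrite /word_mx big_cons -/(word_mx _) mxE.
case: (ltnP r q) => [lt|ge].
  rewrite (bigD1 (Ordinal (lt : r.+1 < q.+1)%N)) //= big1 ?addr0.
    by rewrite IH /letter_mx /= mxE eqxx mul1r addSnnS.
  move=> r' /negbTE ne; rewrite /letter_mx /= mxE.
  by rewrite (_ : (_ == _) = false) ?mul0r // -ne -val_eqE.
rewrite big1 => [|r' _].
  by case: eqP => // E; have := ltn_ord c; rewrite E; lia.
rewrite /letter_mx /= mxE; case: eqP => [E|_]; last by rewrite mul0r.
by have := ltn_ord r'; rewrite E; lia.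
Qed.

(** The word that leads from position r to the end of the block, and from there
    to position c of the next one; it contains x, so it fits at r only. *)
Lemma word_mx_delta (r c : 'I_q.+1) :
  word_mx (nseq (q - r) ly ++ lx :: nseq c ly) = delta_mx r c.
Proof.
have -> : word_mx (nseq (q - r) ly ++ lx :: nseq c ly) =
    word_mx (nseq (q - r) ly) * delta_mx ord_max ord0 * word_mx (nseq c ly).
  by rewrite /word_mx big_cat big_cons -[RHS]mulrA.
apply/matrixP => r' c'; rewrite mul_delta_sandwich !word_mx_y !mxE -natrM mulnb.
congr (_%:R); congr nat_of_bool; rewrite add0n -!val_eqE /=; congr (_ && _).
by have := ltn_ord r; have := ltn_ord r'; lia.
Qed.

Local Notation A := (@mon_alg k 2 ruler_language).

Definition mon_mx (a : A) : Mat := eval_mx (val a).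

Lemma eval_mx_truncate p : eval_mx (truncate ruler_language p) = eval_mx p.
Proof.
elim/free_ind: p => [w||c p r IH IH'].
- rewrite truncate_monomial; case: ifPn => // /asboolPn nLw.
  rewrite linear0 eval_mx_monomial; apply/esym/eqP; apply: contrapT => /negP.
  by move/word_mx_lang.
- by rewrite truncate0.
- by rewrite truncateD truncateZ !linearP /= IH IH'.
Qed.

Lemma mon_mx_linear : linear mon_mx.
Proof. by move=> c a b; rewrite /mon_mx linearP. Qed.
HB.instance Definition _ :=
  GRing.isLinear.Build k A Mat *:%R mon_mx mon_mx_linear.

Lemma mon_mx_monoid : monoid_morphism mon_mx.
Proof.
split; first by rewrite /mon_mx eval_mx_truncate rmorph1.
by move=> a b; rewrite /mon_mx eval_mx_truncate rmorphM.
Qed.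
HB.instance Definition _ :=
  GRing.isMonoidMorphism.Build A Mat mon_mx mon_mx_monoid.

Lemma mon_mx_surjective : surjective mon_mx.
Proof.
move=> B; pose w (r c : 'I_q.+1) := nseq (q - r) ly ++ lx :: nseq c ly.
exists (\sum_r \sum_c B r c *: mon_word k ruler_language (w r c)).
rewrite linear_sum [RHS]matrix_sum_delta; apply: eq_bigr => r _.
rewrite linear_sum; apply: eq_bigr => c _; rewrite linearZ; congr (_ *: _).
by rewrite /= /mon_mx eval_mx_truncate eval_mx_monomial word_mx_delta.
Qed.

End MatrixImages.

Lemma ruler_unbounded (k : fieldType) :
  unbounded_matrix_images (@mon_alg k 2 ruler_language).
Proof.
move=> [N [N0 H]].
have := H _ (@mon_mx k (2 * N)) (mon_mx_surjective (i := 2 * N))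
  (@matrix_prime k _) (@matrix_finite_dimensional k _).
by apply: matrix_standard_identityN; apply/ltnW/ltn_expl.
Qed.

(** * Growth exponents *)

Section GrowthExponent.

(** From a < e (a / e + 1) <= e 2^(a / e), with integer division. *)
Lemma expn_le_exp2 (e a : nat) : (0 < e -> a ^ e <= e ^ e * 2 ^ a)%N.
Proof.
move=> e0; apply: (@leq_trans ((e * 2 ^ (a %/ e)) ^ e)%N).
  rewrite leq_exp2r //; apply: leq_trans (ltnW (ltn_ceil a e0)) _.
  by rewrite mulnC leq_mul2l ltn_expl ?orbT.
by rewrite expnMn -expnM leq_mul2l leq_exp2l // leq_trunc_div orbT.
Qed.

(** A logarithmic factor is absorbed by an arbitrarily small power: the e-th
    power of n^2 (log n)^2 is at most a constant times n^(2 e + 1). *)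
Lemma quasi_quadratic (e D : nat) : (0 < e)%N -> (0 < D)%N ->
  exists C, (0 < C)%N /\ forall n b, (0 < n)%N ->
  (b <= 2 * (trunc_log 2 (D * n)).+2 ^ 2 * (5 * (D * n)).+1 * (D * n).+1)%N ->
  (b ^ e <= C * n ^ (2 * e).+1)%N.
Proof.
move=> e0 D0; set f := (2 * e)%N; have f0 : (0 < f)%N by rewrite muln_gt0.
exists (24 ^ e * f ^ f * 4 * D ^ f.+1)%N; split.
  by rewrite !muln_gt0 !expn_gt0 D0 f0.
move=> n b n0; set m := (D * n)%N; set l := trunc_log 2 m => hb.
have m0 : (0 < m)%N by rewrite muln_gt0 D0.
have {}hb : (b <= 24 * (l.+2 * m) ^ 2)%N.
  apply: leq_trans hb _; rewrite expnMn -[(2 * _ * _ * _)%N]mulnA mulnAC mulnC.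
  rewrite [(24 * _)%N]mulnCA leq_mul2l; apply/orP; right.
  by rewrite expnS expn1; nia.
apply: (@leq_trans ((24 * (l.+2 * m) ^ 2) ^ e)%N); first by rewrite leq_exp2r.
rewrite expnMn -expnM -/f expnMn.
have h1 := expn_le_exp2 l.+2 f0.
have h2 : (2 ^ l <= m)%N by apply: trunc_logP.
apply: (@leq_trans (24 ^ e * (f ^ f * (4 * m) * m ^ f))%N).
  rewrite leq_mul2l leq_mul2r; apply/orP; right; apply/orP; right.
  apply: leq_trans h1 _; rewrite leq_mul2l; apply/orP; right.
  by rewrite !expnS mulnA leq_mul2l h2 orbT.
rewrite -[X in (_ <= X)%N]mulnA -expnMn -/m (expnS m f); apply: eq_leq.
by rewrite -!mulnA.
Qed.

Local Open Scope ring_scope.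
Local Open Scope classical_set_scope.

Lemma growth_exponent_quadratic (R : realType)
    (delta : nat -> nat) (D E : nat) :
  (0 < D)%N -> (0 < E)%N ->
  (forall n, (0 < n)%N -> (delta n <=
     2 * (trunc_log 2 (D * n)).+2 ^ 2 * (5 * (D * n)).+1 * (D * n).+1)%N) ->
  (forall n, ((n %/ E) ^ 2 <= delta n)%N) ->
  limn_esup (fun n => (ln (delta n)%:R / ln n%:R : R)%:E) = (2%:R : R)%:E.
Proof.
move=> D0 E0 up low.
apply: (cvg_limn_einf_sup _).2; apply: cvg_EFin; first exact: nearW.
apply/cvgrPdist_le => eps eps0.
have [e [e0 he]] : exists e : nat, (0 < e)%N /\ e%:R^-1 <= eps / 2.
  have h : 0 <= (eps / 2)^-1 by rewrite invr_ge0 ltW // divr_gt0.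
  exists (Num.truncn (eps / 2)^-1).+1; split=> //.
  rewrite invf_ple ?posrE ?ltr0n ?divr_gt0 //; exact/ltW/truncnS_gt.
have [C [C0 hC]] := quasi_quadratic e0 D0.
(* Once ln n >= K, division by ln n makes the constants C and 4 E^2 cost at
   most eps. *)
pose K :=
  Num.max 1 (Num.max (ln C%:R * (2 / eps)) (ln (4 * E ^ 2)%:R / eps) : R).
near=> n.
have n0 : (0 < n)%N by near: n; exact: nbhs_infty_gt.
have nE : (2 * E <= n)%N by near: n; exact: nbhs_infty_ge.
have nK : expR K <= n%:R by near: n; exact: nbhs_infty_ger.
have n0R : (0 : R) < n%:R by rewrite ltr0n.
have : K <= ln n%:R by rewrite -(expRK K) ler_ln ?posrE ?expR_gt0.
rewrite /K !ge_max => /and3P[ln1 lnC lnE].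
have ln0 : 0 < ln (n%:R : R) by apply: lt_le_trans ln1.
have d0 : (0 < delta n)%N.
  apply: leq_trans (low n).
  by rewrite expn_gt0 divn_gt0 // (leq_trans _ nE) // leq_pmull.
have e0R : (0 : R) < e%:R by rewrite ltr0n.
have hup : e%:R * ln (delta n)%:R <= ln C%:R + (2 * e%:R + 1) * ln (n%:R : R).
  have := hC n _ n0 (up n n0); rewrite -(ler_nat R) => h.
  have : ln ((delta n ^ e)%:R : R) <= ln (C * n ^ (2 * e).+1)%:R.
    by rewrite ler_ln ?posrE ?ltr0n ?muln_gt0 ?expn_gt0 ?d0 ?C0 ?n0.
  rewrite natrX lnXn ?ltr0n // natrM lnM ?posrE ?ltr0n ?expn_gt0 ?n0 //.
  rewrite natrX lnXn // -[X in X <= _]mulr_natl -[X in _ <= _ + X]mulr_natl.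
  by rewrite -[(2 * e).+1]addn1 natrD natrM.
have hlow : 2 * ln (n%:R : R) <= ln (4 * E ^ 2)%:R + ln (delta n)%:R.
  have h : (n ^ 2 <= 4 * E ^ 2 * delta n)%N.
    apply: leq_trans (leq_mul (leqnn _) (low n)).
    rewrite -[4%N]/(2 ^ 2)%N -!expnMn leq_exp2r //.
    apply: leq_trans (ltnW (ltn_ceil n E0)) _; rewrite mulnAC leq_mul2r.
    have : (0 < n %/ E)%N by rewrite divn_gt0 // (leq_trans _ nE) // leq_pmull.
    by move=> q0; rewrite mul2n -addnn -addn1 leq_add2l q0 orbT.
  have : ln ((n ^ 2)%:R : R) <= ln (4 * E ^ 2 * delta n)%:R.
    by rewrite ler_ln ?posrE ?ltr0n ?ler_nat ?muln_gt0 ?expn_gt0 ?d0 ?E0 ?n0.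
  rewrite natrX lnXn // -[X in X <= _]mulr_natl (natrM _ (4 * E ^ 2)%N).
  by rewrite lnM ?posrE ?ltr0n ?muln_gt0 ?expn_gt0 ?E0.
rewrite /=; set a := ln n%:R in ln1 lnC lnE ln0 hup hlow *.
set b := ln (delta n)%:R in hup hlow *.
rewrite ler_norml; apply/andP; split.
  rewrite lerBrDl -lerBrDr opprK ler_pdivrMr //.
  rewrite -(ler_pM2l e0R); apply: le_trans hup _.
  have h1 : ln C%:R <= a * (eps / 2) * e%:R.
    apply: (@le_trans _ _ (a * (eps / 2))).
      by rewrite -ler_pdivrMr ?divr_gt0 // invf_div.
    by rewrite ler_peMr ?ler1n // mulr_ge0 ?divr_ge0 // ltW.
  have h2 : 1 <= e%:R * (eps / 2).
    by rewrite mulrC -ler_pdivrMr // div1r.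
  have h3 : a <= a * (e%:R * (eps / 2)) by rewrite ler_peMr // ltW.
  by lra.
rewrite lerBlDr -lerBlDl ler_pdivlMr //.
have : ln (4 * E ^ 2)%:R <= a * eps by rewrite -ler_pdivrMr.
by lra.
Unshelve. all: by end_near.
Qed.

End GrowthExponent.
(** * The growth of an arbitrary frame *)

Section Frames.
Local Open Scope ring_scope.
Local Open Scope classical_set_scope.
Variables (k : fieldType) (d : nat) (L : language d).
Local Notation A := (@mon_alg k d L).
Implicit Types (V : set A).

Lemma frame_deg_le V : frame V ->
  exists2 D, (0 < D)%N &
    forall n, subspace_exp V n `<=` @deg_le k d L (D * n).
Proof.
move=> [[s Vs] _ _].
have [D hD] : exists D, forall a, a \in s -> @deg_le k d L D a.
  elim: (s) => [|a t [D hD]]; first by exists 0%N.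
  have [m hm] := deg_le_exists a; exists (maxn m D) => b.
  rewrite inE => /orP[/eqP ->|/hD h].
    exact: deg_le_mono (leq_maxl _ _) hm.
  exact: deg_le_mono (leq_maxr _ _) h.
exists D.+1 => // n; apply: lin_span_min; first exact: deg_le_subspace.
move=> _ [v hv <-]; apply: deg_le_prod => i; apply: (deg_le_mono (leqnSn D)).
have := hv i; rewrite Vs; apply: lin_span_min; first exact: deg_le_subspace.
by move=> a; exact: hD.
Qed.

Lemma frame_words V : frame V ->
  exists2 E, (0 < E)%N & forall w m,
    (E * size w <= m)%N -> subspace_exp V m (mon_word k L w).
Proof.
move=> [_ V1 gV].
have /choice[e he] : forall i, exists n, subspace_exp V n (mon_word k L [:: i]).
  by move=> i; exact: generates_subspace_exp.
exists (\max_i e i).+1 => // w m hm; apply: (subspace_exp_mono V1 hm).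
elim: w {m hm} => [|i w IH].
  by rewrite mon_word_nil; exact: subspace_exp1.
rewrite -cat1s mon_wordM size_cat mulnDr; apply: subspace_expD IH.
apply: (subspace_exp_mono V1 _ (he i)); rewrite muln1.
by apply: leqW; exact: leq_bigmax.
Qed.

End Frames.

Section RulerGrowth.
Local Open Scope nat_scope.

Definition two_gaps (p : nat * nat) : word 2 :=
  nseq p.1 ly ++ lx :: nseq p.2 ly.

Lemma two_gaps_inj : injective two_gaps.
Proof.
move=> [a b] [a' b'] e.
have idx c n : index lx (two_gaps (c, n)) = c.
  by rewrite /two_gaps index_cat mem_nseq andbF /= size_nseq addn0.
have ea : a = a' by rewrite -(idx a b) e idx.
have := congr1 size e; rewrite /two_gaps /= !size_cat /= !size_nseq ea.
by move/addnI => [->].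
Qed.

(** The h^2 words y^a x y^b with a, b < h have length less than 2 h, so they lie
    in the power 2 h E of V, if V^E contains the letters. *)
Lemma ruler_frame_growth (k : fieldType)
    (V : set (@mon_alg k 2 ruler_language)) :
  frame V -> exists D E, [/\ 0 < D, 0 < E,
   forall n, 0 < n -> subspace_dim (subspace_exp V n) <=
     2 * (trunc_log 2 (D * n)).+2 ^ 2 * (5 * (D * n)).+1 * (D * n).+1 &
   forall n, (n %/ E) ^ 2 <= subspace_dim (subspace_exp V n)].
Proof.
move=> fV; have [D D0 hD] := frame_deg_le fV; have [E E0 hE] := frame_words fV.
pose mw := mon_word k ruler_language.
have cover n : 0 < n -> exists2 s : seq (word 2),
    size s <= 2 * (trunc_log 2 (D * n)).+2 ^ 2 * (5 * (D * n)).+1 * (D * n).+1 &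
    (subspace_exp V n `<=` lin_span [set` map mw s])%classic.
  move=> n0; have Dn0 : 0 < D * n by rewrite muln_gt0 D0.
  have [s hs Ls] := ruler_lang_upper Dn0.
  by exists s => // a /hD; exact: word_span.
exists D, (2 * E); split=> // [|n n0|[|n]].
- by rewrite muln_gt0.
- have [s hs Vs] := cover n n0; apply: leq_trans hs; rewrite -(size_map mw).
  exact: subspace_dim_le (subspace_exp_subspace _ _) Vs.
- by rewrite div0n.
have [s _ Vs] := cover n.+1 isT; set h := _ %/ _.
pose t := [seq two_gaps p | p <- allpairs pair (iota 0 h) (iota 0 h)].
have -> : h ^ 2 = size (map mw t).
  by rewrite !size_map size_allpairs size_iota mulnn.
apply: subspace_dim_ge (subspace_exp_subspace _ _) Vs _ _.
  apply: word_indep.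
    rewrite map_inj_uniq; last exact: two_gaps_inj.
    by apply: allpairs_uniq; rewrite ?iota_uniq // => [[? ?] [? ?]].
  by move=> w /mapP[p _ ->]; exact: ruler_lang_two_gaps.
move=> a /mapP[w /mapP[p /allpairsP[[c e] /= [hc he ->]] ->] ->].
apply: hE; rewrite /two_gaps /= size_cat /= !size_nseq.
move: hc he; rewrite !mem_iota /= => hc he.
apply: leq_trans (leq_trunc_div n.+1 (2 * E)).
rewrite -/h [2 * E]mulnC mulnCA leq_mul2l.
by apply/orP; right; lia.
Qed.

End RulerGrowth.

(** * The theorem *)

Theorem theorem1p6 (R : realType) (k : fieldType) :
  exists A : algType k,
    [/\ finitely_generated A,
        prime_ring A,
        monomial_algebra A,
        has_GKdim A (2%:R : R)%:E
      & unbounded_matrix_images A].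
Proof.
exists (@mon_alg k 2 ruler_language); split.
- exact: mon_finitely_generated.
- exact/mon_prime/ruler_lang_prime.
- exact: mon_algP.
- split; first exact: mon_finitely_generated.
  move=> V /ruler_frame_growth[D [E [D0 E0 up low]]].
  exact: growth_exponent_quadratic D0 E0 up low.
- exact: ruler_unbounded.
Qed.
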